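(* Minimum Sum Coloring with Bundles with uniform weights ($w(B)=1$ for all $B\in\mathcal{B}$) can be solved in polynomial time on instances in which $G$ is bipartite and $|\mathcal{B}|\le 3$.
   Context: Minimum Sum Coloring with Bundles: given an undirected graph $G=(V,E)$, a family $\mathcal{B}=\{B_1,\dots,B_\ell\}$ of non-empty subsets of $V$ (bundles) such that every vertex lies in at least one bundle, a weight function $w\colon\mathcal{B}\to\mathbb{Z}_{>0}$ and a positive integer $C$, decide whether there exists a proper coloring $c\colon V\to\mathbb{Z}_{>0}$ (i.e. $c(u)\ne c(v)$ for every edge $uv$) with $\sum_{j=1}^{\ell} w(B_j)\max\{c(v)\mid v\in B_j\}\le C$. Bundles need not be disjoint. *)

(* Defs.v *)
From HB Require Import structures.
From mathcomp Require Import all_boot all_order all_algebra.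

Set Implicit Arguments.
Unset Strict Implicit.
Unset Printing Implicit Defensive.

(** * Deterministic multi-tape Turing machines *)

(* A two-way infinite tape with finitely many visited cells; the cells to the
   left of the head are listed starting from the head. *)
Record tape (S : Type) := Tape {
  tape_left : seq S;
  tape_head : S;
  tape_right : seq S
}.

Inductive move := MoveLeft | Stay | MoveRight.

Definition tape_write S (s : S) (t : tape S) : tape S :=
  Tape (tape_left t) s (tape_right t).

Definition tape_move S (blank : S) (m : move) (t : tape S) : tape S :=
  let: Tape l h r := t in
  match m with
  | MoveLeft => if l is s :: l' then Tape l' s (h :: r)
                else Tape [::] blank (h :: r)
  | Stay => t
  | MoveRight => if r is s :: r' then Tape (h :: l) s r'
                 else Tape (h :: l) blank [::]
  end.

(* A cell is blank ([None]), or holds an input symbol or a work symbol. *)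
Definition cell (A W : finType) : finType := option (A + W)%type.

(* [tm_verdict q = Some b] means that [q] is a halting state, accepting or
   rejecting according to [b].  There are [tm_work_tapes] tapes besides the
   input tape, which is tape [ord0].  As the domain of [tm_delta] is a finite
   type, every such function is a finite transition table. *)
Record TM (A : finType) := MkTM {
  tm_state : finType;
  tm_symbol : finType;
  tm_work_tapes : nat;
  tm_start : tm_state;
  tm_verdict : tm_state -> option bool;
  tm_delta :
    tm_state -> {ffun 'I_tm_work_tapes.+1 -> cell A tm_symbol} ->
    tm_state * {ffun 'I_tm_work_tapes.+1 -> cell A tm_symbol * move}
}.

Record config (A : finType) (M : TM A) := Config {
  cfg_state : tm_state M;
  cfg_tapes : {ffun 'I_(tm_work_tapes M).+1 -> tape (cell A (tm_symbol M))}
}.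

Definition tm_step (A : finType) (M : TM A) (c : config M) : config M :=
  if tm_verdict (cfg_state c) is Some _ then c
  else
    let: (q, act) :=
      tm_delta (cfg_state c) [ffun i => tape_head (cfg_tapes c i)] in
    Config q [ffun i => tape_move None (act i).2
                          (tape_write (act i).1 (cfg_tapes c i))].

Definition input_tape (A W : finType) (x : seq A) : tape (cell A W) :=
  if x is a :: x' then Tape [::] (Some (inl a)) [seq Some (inl b) | b <- x']
  else Tape [::] None [::].

Definition tm_init (A : finType) (M : TM A) (x : seq A) : config M :=
  Config (tm_start M)
    [ffun i => if i == ord0 then input_tape (tm_symbol M) x
               else Tape [::] None [::]].

(* Halting configurations are fixed by [tm_step], so this says that [M] halts
   on [x] after at most [t] steps, with answer [b]. *)
Definition tm_answers_within (A : finType) (M : TM A) (x : seq A) (t : nat)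
    (b : bool) : Prop :=
  tm_verdict (cfg_state (iter t (@tm_step A M) (tm_init M x))) = Some b.

(* The decision problem "does [yes I] hold?", for the instances [I] such that
   [valid I], given to the machine as the word [enc I]. *)
Definition poly_time_solvable_on (T : Type) (A : finType) (enc : T -> seq A)
    (valid yes : T -> Prop) : Prop :=
  exists (M : TM A) (p : {poly nat}),
    forall I : T, valid I ->
      exists b : bool,
        tm_answers_within M (enc I) (horner p (size (enc I))) b /\
        (b <-> yes I).

(** * Minimum Sum Coloring with Bundles *)

(* The bundles form an indexed family, so they may also be repeated. *)
Record instance := Instance {
  nvertices : nat;
  adj : rel 'I_nvertices;
  adj_sym : symmetric adj;
  adj_irr : irreflexive adj;
  nbundles : nat;
  bundle : 'I_nbundles -> {set 'I_nvertices};
  bundle_neq0 : forall j, bundle j != set0;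
  bundle_cover : forall v, exists j, v \in bundle j;
  weight : 'I_nbundles -> nat;
  weight_gt0 : forall j, 0 < weight j;
  budget : nat;
  budget_gt0 : 0 < budget
}.

Definition proper_coloring (I : instance) (c : 'I_(nvertices I) -> nat) : Prop :=
  (forall v, 0 < c v) /\ (forall u v, adj u v -> c u <> c v).

Definition bundle_cost (I : instance) (c : 'I_(nvertices I) -> nat) : nat :=
  \sum_(j < nbundles I) weight j * \max_(v in bundle j) c v.

Definition mscb (I : instance) : Prop :=
  exists c : 'I_(nvertices I) -> nat, proper_coloring c /\ bundle_cost c <= budget I.

Definition bipartite (I : instance) : Prop :=
  exists X : {set 'I_(nvertices I)},
    forall u v, adj u v -> (u \in X) != (v \in X).

Definition uniform_weights (I : instance) : Prop :=
  forall j : 'I_(nbundles I), weight j = 1.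

(** * Encoding of instances *)

(* [Some b] is a bit and [None] is a separator. *)
Definition letter : finType := option bool.

(* The binary digits of a positive number, least significant first. *)
Definition binary (n : nat) : seq letter :=
  mkseq (fun i => Some (odd (n %/ 2 ^ i))) (trunc_log 2 n).+1.

Definition indicator (n : nat) (X : {set 'I_n}) : seq letter :=
  [seq Some (v \in X) | v <- enum 'I_n].

(* The rows of the adjacency matrix, then the indicator vector and the weight
   of each bundle, then the budget.  Each item of the first two lists is
   terminated by a separator, and an additional separator ends each list.
   This is uniquely decodable: rows and indicator vectors are non-empty words
   of bits unless there are no vertices, hence no (non-empty) bundles. *)
Definition encode (I : instance) : seq letter :=
  flatten [seq rcons (indicator [set v | adj u v]) None
          | u <- enum 'I_(nvertices I)]
  ++ None ::
  flatten [seq rcons (indicator (bundle j)) None ++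
               rcons (binary (weight j)) None
          | j <- enum 'I_(nbundles I)]
  ++ None :: binary (budget I).

(* Main.v *)
(**
Let k_j be the largest color in bundle j and let D be the set of bundles with
k_j = 1; every vertex of a bundle of D has color 1.  With m <= 3 bundles, an
instance on a bipartite graph is positive iff, for some set D of bundles,
either the vertices of the bundles of D all get color 1 in some coloring with
the colors 1 and 2, and 2m - |D| <= C, or these vertices are independent and
3m - 2|D| <= C (color the other ones with 2 and 3).  Indeed, if some k_j >= 3
then the cost is at least 2m - |D| + 1, so either |D| <= 1 and a plain
2-coloring is cheap enough, or m = 3, |D| = 2 and 5 <= C.

The coloring with 1 and 2 exists iff no vertex is reached both by a walk of
even length and by a walk of odd length from vertices of bundles of D.  These
reachability facts, for all D at once, form a finite label of each vertex, and
the machine propagates labels along the adjacency matrix until they are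
stable.  There are boundedly many entries per label, hence linearly many
rounds, each quadratic.
*)

Require Import Defs.
From HB Require Import structures.
From mathcomp Require Import all_boot all_order all_algebra zify ring.

Set Implicit Arguments.
Unset Strict Implicit.
Unset Printing Implicit Defensive.

(** * Tapes as zippers *)

Section Zippers.
Variable X : Type.
Implicit Types (s : seq (option X)) (z : seq (option X) * seq (option X)).

(* Half-tapes agree up to trailing blanks, which visiting a cell creates. *)
Definition padeq s s' := forall k, nth None s k = nth None s' k.

Definition zeq z z' := padeq z.1 z'.1 /\ padeq z.2 z'.2.

Definition zhead z := head None z.2.

Definition zwrite a z := (z.1, a :: behead z.2).

Definition zmove m z :=
  match m with
  | MoveLeft => (behead z.1, head None z.1 :: z.2)
  | Stay => z
  | MoveRight => (head None z.2 :: z.1, behead z.2)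
  end.

Definition zipper (t : tape (option X)) :=
  (tape_left t, tape_head t :: tape_right t).

Lemma zeq_trans z1 z2 z3 : zeq z1 z2 -> zeq z2 z3 -> zeq z1 z3.
Proof. by move=> [h1 h2] [h3 h4]; split=> k; rewrite ?h1 ?h2. Qed.

Lemma zhead_eq z z' : zeq z z' -> zhead z = zhead z'.
Proof. by case=> _ /(_ 0); rewrite !nth0. Qed.

Lemma padeq_behead s s' : padeq s s' -> padeq (behead s) (behead s').
Proof. by move=> h k; rewrite !nth_behead. Qed.

Lemma padeq_cons a s s' : padeq s s' -> padeq (a :: s) (a :: s').
Proof. by move=> h [|k] //=. Qed.

Lemma padeq_head s s' : padeq s s' -> head None s = head None s'.
Proof. by move/(_ 0); rewrite !nth0. Qed.

Lemma zwrite_eq a z z' : zeq z z' -> zeq (zwrite a z) (zwrite a z').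
Proof. by case=> h1 h2; split=> //=; apply/padeq_cons/padeq_behead. Qed.

Lemma zmove_eq m z z' : zeq z z' -> zeq (zmove m z) (zmove m z').
Proof.
case=> h1 h2; case: m => //=; split=> //=;
  by [apply: padeq_behead | rewrite (padeq_head h1); apply: padeq_cons
     | rewrite (padeq_head h2); apply: padeq_cons].
Qed.

Lemma zwrite_zhead z : zeq (zwrite (zhead z) z) z.
Proof. by case: z => l [|a r]; split=> //= -[|k] //=; rewrite nth_nil. Qed.

Lemma zipper_move m t : zeq (zipper (tape_move None m t)) (zmove m (zipper t)).
Proof.
case: t => l h r; case: m => //; first by case: l => [|a l]; split=> // k.
by case: r => [|a r]; split=> //= -[|[]].
Qed.

End Zippers.

(** * Machines with three tapes *)

Section ThreeTapes.
Variables (A W Q : finType) (start : Q) (verdict : Q -> option bool).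
Variable trans : Q -> cell A W -> cell A W -> cell A W ->
  Q * move * (option W * move) * (option W * move).

Let tape1 : 'I_3 := @Ordinal 3 1 isT.
Let tape2 : 'I_3 := @Ordinal 3 2 isT.

Definition overwrite (o : option W) (c : cell A W) : cell A W :=
  if o is Some w then Some (inr w) else c.

Definition three_tape_TM : TM A :=
  @MkTM A Q W 2 start verdict (fun q h =>
    let: (q', m0, (o1, m1), (o2, m2)) :=
      trans q (h ord0) (h tape1) (h tape2) in
    (q', [ffun i => if i == ord0 then (h ord0, m0)
                    else if i == tape1 then (overwrite o1 (h tape1), m1)
                    else (overwrite o2 (h tape2), m2)])).

Notation zip_tape := (seq (cell A W) * seq (cell A W))%type.

Record zconfig := ZC { zq : Q; zt0 : zip_tape; zt1 : zip_tape; zt2 : zip_tape }.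

Definition zceq a b := [/\ zq a = zq b, zeq (zt0 a) (zt0 b),
  zeq (zt1 a) (zt1 b) & zeq (zt2 a) (zt2 b)].

(** [None] writes nothing, whereas the Turing machine rewrites the symbol it reads; [zwrite_zhead]
    reconciles the two up to padding. *)
Definition update (a : option W * move) (z : zip_tape) : zip_tape :=
  zmove a.2 (if a.1 is Some w then zwrite (Some (inr w)) z else z).

Definition zstep a :=
  if verdict (zq a) is Some _ then a else
  let: (q, m0, a1, a2) :=
    trans (zq a) (zhead (zt0 a)) (zhead (zt1 a)) (zhead (zt2 a)) in
  ZC q (zmove m0 (zt0 a)) (update a1 (zt1 a)) (update a2 (zt2 a)).

(** An upper bound on the steps and equality up to padding let runs compose with additive bounds. *)
Definition reach k a b := exists2 t, t <= k & zceq (iter t zstep a) b.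

Lemma zceq_trans a b c : zceq a b -> zceq b c -> zceq a c.
Proof.
move=> [h0 h1 h2 h3] [g0 g1 g2 g3]; split; first by rewrite h0.
- exact: zeq_trans h1 g1.
- exact: zeq_trans h2 g2.
- exact: zeq_trans h3 g3.
Qed.

Lemma update_eq a z z' : zeq z z' -> zeq (update a z) (update a z').
Proof. by case: a => -[w|] m h; apply: zmove_eq => //; apply: zwrite_eq. Qed.

Lemma zstep_eq a b : zceq a b -> zceq (zstep a) (zstep b).
Proof.
case: a b => q z0 z1 z2 [q' y0 y1 y2] [/= <- h0 h1 h2].
rewrite /zstep /= -(zhead_eq h0) -(zhead_eq h1) -(zhead_eq h2).
case: (verdict q) => [_|] //; case: (trans _ _ _ _) => [[[p m0] a1] a2].
by split=> //=; [apply: zmove_eq | apply: update_eq | apply: update_eq].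
Qed.

Lemma iter_zstep_eq t a b : zceq a b -> zceq (iter t zstep a) (iter t zstep b).
Proof. by move=> h; elim: t => //= t IH; apply: zstep_eq. Qed.

Lemma reach0 k a b : zceq a b -> reach k a b.
Proof. by move=> h; exists 0. Qed.

Lemma reachS k a b : reach k (zstep a) b -> reach k.+1 a b.
Proof. by case=> t ht h; exists t.+1; rewrite ?iterSr. Qed.

Lemma reach_trans k k' b a c :
  reach k a b -> reach k' b c -> reach (k + k') a c.
Proof.
move=> [t ht h] [t' ht' h']; exists (t' + t); first by lia.
by rewrite iterD; apply: zceq_trans h'; apply: iter_zstep_eq.
Qed.

Lemma reach_leq k k' a b : k <= k' -> reach k a b -> reach k' a b.
Proof. by move=> hk [t ht h]; exists t => //; apply: leq_trans hk. Qed.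

Lemma reach_eql k a a' b : zceq a a' -> reach k a' b -> reach k a b.
Proof. by move=> h; apply: (@reach_trans 0); apply: reach0. Qed.

Definition zconfig_of (c : config three_tape_TM) :=
  ZC (cfg_state c) (zipper (cfg_tapes c ord0)) (zipper (cfg_tapes c tape1))
    (zipper (cfg_tapes c tape2)).

Local Arguments tape_move : simpl never.

Lemma zconfig_of_step c :
  zceq (zconfig_of (tm_step c)) (zstep (zconfig_of c)).
Proof.
case: c => q t; rewrite /tm_step /zstep /=.
case: (verdict q) => [_|] //; rewrite !ffunE.
rewrite /zhead /=; case: (trans _ _ _ _) => [[[p m0] [o1 m1]] [o2 m2]].
split=> //=; rewrite !ffunE /=.
- apply: zeq_trans (zipper_move _ _) _; apply: zmove_eq.
  exact: (zwrite_zhead (zipper (t _))).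
- apply: zeq_trans (zipper_move _ _) _; apply: zmove_eq.
  by case: o1 => [w|] //=; apply: (zwrite_zhead (zipper (t _))).
- apply: zeq_trans (zipper_move _ _) _; apply: zmove_eq.
  by case: o2 => [w|] //=; apply: (zwrite_zhead (zipper (t _))).
Qed.

(** Halting configurations are fixed, so a verdict reached early is still there after exactly [k]
    steps. *)
Lemma answers_of_reach (x : seq A) k b a :
  reach k (ZC start ([::], [seq Some (inl c) | c <- x]) ([::], [::])
    ([::], [::])) a ->
  verdict (zq a) = Some b -> tm_answers_within three_tape_TM x k b.
Proof.
case=> t ht h hb; rewrite /tm_answers_within -(subnK ht) iterD.
set c0 := tm_init _ _.
have h0 : zceq (zconfig_of c0)
    (ZC start ([::], [seq Some (inl c) | c <- x]) ([::], [::]) ([::], [::])).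
  split=> //=; rewrite ffunE /=.
  - by case: (x) => [|a0 x0]; split=> // -[|[]].
  - by split=> //= -[|[]].
  - by split=> //= -[|[]].
have sim u : zceq (zconfig_of (iter u (@tm_step A three_tape_TM) c0))
    (iter u zstep (zconfig_of c0)).
  elim: u => //= u IH; apply: zceq_trans (zconfig_of_step _) _.
  exact: zstep_eq.
have [/= hq _ _ _] : zceq (zconfig_of (iter t (@tm_step A three_tape_TM) c0)) a.
  apply: zceq_trans (sim t) _; apply: zceq_trans h.
  exact: iter_zstep_eq.
set c := iter t _ c0 in hq *.
have hv : tm_verdict (cfg_state c) = Some b by rewrite /= hq.
suff -> : iter (k - t) (@tm_step A three_tape_TM) c = c by [].
by elim: (k - t) => //= u ->; rewrite /tm_step hv.
Qed.

End ThreeTapes.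

(** * The label propagation machine *)

(* In [phase], the number of bundles and [minn (budget I) 7].  While the budget
   is being read: the number of digits read, at most 3, and their value. *)
Definition counters : finType := ('I_4 * 'I_8)%type.

(* Tape 0 is the input and is never overwritten, tape 1 holds the labels of the
   previous round and tape 2 those being computed.  A round consists of [Copy]
   (tape 2 to tape 1) and of [Row] and [Scan] on each row of the adjacency
   matrix; the boolean of [Row] and [Scan] tells whether a label has changed.
   [RewindOut true] leads to the next round, [RewindOut false] to the rows. *)
Inductive phase (T T' : finType) :=
  | SkipRows of bool
  | Bundles of 'I_4
  | ReadBundle of 'I_4
  | Weight of 'I_4
  | Budget of 'I_4 & counters
  | Copy of counters
  | RewindOut of bool & counters
  | Row of counters & bool
  | Scan of counters & bool & {set T}
  | Final of counters & {set T'}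
  | Halt of bool.

Section PhaseFinite.
Variables T T' : finType.

(** [phase] inherits its finiteness from this sum, since machine states must form a [finType]. *)
Definition phase_code : finType :=
  (bool + ('I_4 + ('I_4 + ('I_4 + ('I_4 * counters + (counters +
   (bool * counters + (counters * bool + (counters * bool * {set T} +
   (counters * {set T'} + bool))))))))))%type.

Definition code_phase (q : phase T T') : phase_code :=
  match q with
  | SkipRows b => inl b
  | Bundles j => inr (inl j)
  | ReadBundle j => inr (inr (inl j))
  | Weight j => inr (inr (inr (inl j)))
  | Budget j d => inr (inr (inr (inr (inl (j, d)))))
  | Copy d => inr (inr (inr (inr (inr (inl d)))))
  | RewindOut b d => inr (inr (inr (inr (inr (inr (inl (b, d)))))))
  | Row d b => inr (inr (inr (inr (inr (inr (inr (inl (d, b))))))))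
  | Scan d b L => inr (inr (inr (inr (inr (inr (inr (inr (inl (d, b, L)))))))))
  | Final d E =>
    inr (inr (inr (inr (inr (inr (inr (inr (inr (inl (d, E))))))))))
  | Halt b => inr (inr (inr (inr (inr (inr (inr (inr (inr (inr b)))))))))
  end.

Definition decode_phase (c : phase_code) : phase T T' :=
  match c with
  | inl b => SkipRows T T' b
  | inr (inl j) => Bundles T T' j
  | inr (inr (inl j)) => ReadBundle T T' j
  | inr (inr (inr (inl j))) => Weight T T' j
  | inr (inr (inr (inr (inl (j, d))))) => Budget T T' j d
  | inr (inr (inr (inr (inr (inl d))))) => Copy T T' d
  | inr (inr (inr (inr (inr (inr (inl (b, d))))))) => RewindOut T T' b d
  | inr (inr (inr (inr (inr (inr (inr (inl (d, b)))))))) => Row T T' d b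
  | inr (inr (inr (inr (inr (inr (inr (inr (inl (d, b, L))))))))) =>
    Scan T' d b L
  | inr (inr (inr (inr (inr (inr (inr (inr (inr (inl (d, E)))))))))) =>
    Final T d E
  | inr (inr (inr (inr (inr (inr (inr (inr (inr (inr b))))))))) => Halt T T' b
  end.

Lemma code_phaseK : cancel code_phase decode_phase. Proof. by case. Qed.

HB.instance Definition _ := Countable.copy (phase T T') (can_type code_phaseK).
HB.instance Definition _ : isFinite (phase T T') := CanIsFinite code_phaseK.

End PhaseFinite.

Arguments SkipRows {T T'}.
Arguments Bundles {T T'}.
Arguments ReadBundle {T T'}.
Arguments Weight {T T'}.
Arguments Budget {T T'}.
Arguments Copy {T T'}.
Arguments RewindOut {T T'}.
Arguments Row {T T'}.
Arguments Scan {T T'}.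
Arguments Final {T T'}.
Arguments Halt {T T'}.

Section Machine.
Variables T T' : finType.

(* The bundles that contain the vertex, and the entries found so far. *)
Definition label : finType := ({set 'I_4} * {set T})%type.

(** [contrib] is what a label passes on to a neighbor, [final] what it adds to the set on which
    [decide] bases the answer. *)
Variables (contrib : label -> {set T}) (final : label -> {set T'}).
Variable decide : counters -> {set T'} -> bool.

(* In state [inr (i, q)], the machine rewinds tape [i] and then enters [q]. *)
Definition state : finType := (phase T T' + 'I_3 * phase T T')%type.

Notation cellT := (cell letter label).

Definition verdict (q : state) : option bool :=
  if q is inl (Halt b) then Some b else None.

Definition letter_of (c : cellT) : option letter :=
  if c is Some (inl x) then Some x else None.

(* A blank reads as the empty label, so that the first bundle is not special. *)
Definition label_of (c : cellT) : label :=
  if c is Some (inr w) then w else (set0, set0).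

(* Four digits or more mean a budget of at least 8, as the most significant
   digit is 1; saturating is harmless since 6 always suffices. *)
Definition add_digit (d : counters) (b : bool) : counters :=
  (inZp (minn 3 d.1.+1),
   inZp (if d.1 == 3 :> nat then 7 else d.2 + b * 2 ^ d.1)).

Definition add_bundle (j : 'I_4) (b : bool) (S : {set 'I_4}) : {set 'I_4} :=
  if b then j |: S else S.

Definition run (q : phase T T') (m0 : move) (o1 : option label) (m1 : move)
    (o2 : option label) (m2 : move) :
    state * move * (option label * move) * (option label * move) :=
  (inl q, m0, (o1, m1), (o2, m2)).

Definition stop b := run (Halt b) Stay None Stay None Stay.

(* The head may be on the blank after the last symbol: rewinding starts with an
   unconditional move to the left. *)
Definition rewind (q : phase T T') (i : nat) (m0 : move) (o2 : option label)
    (m2 : move) :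
    state * move * (option label * move) * (option label * move) :=
  (inr (inord i, q), (if i == 0 then MoveLeft else m0),
   (None, if i == 1 then MoveLeft else Stay),
   (o2, if i == 2 then MoveLeft else m2)).

(** In [SkipRows], [fresh] holds at the start of a row, where a separator ends the matrix. [Bundles]
    and [Row] test the next letter for a similar purpose and leave a bit unread. A blank on a work
    tape ends the labels. *)
Definition phase_trans (q : phase T T') (c0 c1 c2 : cellT) :
    state * move * (option label * move) * (option label * move) :=
  match q, letter_of c0 with
  | SkipRows fresh, Some (Some _) =>
    run (SkipRows false) MoveRight None Stay None Stay
  | SkipRows fresh, Some None =>
    run (if fresh then Bundles ord0 else SkipRows true)
      MoveRight None Stay None Stay
  | Bundles j, Some (Some _) => run (ReadBundle j) Stay None Stay None Stay
  | Bundles j, Some None =>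
    run (Budget j (ord0, ord0)) MoveRight None Stay None Stay
  | ReadBundle j, Some (Some b) =>
    let w := label_of c2 in
    run (ReadBundle j) MoveRight None Stay
      (Some (add_bundle j b w.1, w.2)) MoveRight
  | ReadBundle j, Some None => rewind (Weight j) 2 MoveRight None Stay
  | Weight j, Some (Some _) => run (Weight j) MoveRight None Stay None Stay
  | Weight j, Some None =>
    run (Bundles (inZp j.+1)) MoveRight None Stay None Stay
  | Budget m d, Some (Some b) =>
    run (Budget m (add_digit d b)) MoveRight None Stay None Stay
  | Budget m d, None => rewind (Copy (m, d.2)) 0 Stay None Stay
  | Copy d, _ =>
    if c2 is Some _ then
      run (Copy d) Stay (Some (label_of c2)) MoveRight None MoveRight
    else rewind (RewindOut false d) 1 Stay None Stay
  | RewindOut again d, _ =>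
    rewind (if again then Copy d else Row d false) 2 Stay None Stay
  | Row d changed, Some (Some _) =>
    run (Scan d changed (label_of c2).2) Stay None Stay None Stay
  | Row d changed, Some None =>
    if changed then rewind (RewindOut true d) 0 Stay None Stay
    else run (Final d set0) Stay None Stay None Stay
  | Scan d changed L, Some (Some b) =>
    run (Scan d changed (if b then L :|: contrib (label_of c1) else L))
      MoveRight None MoveRight None Stay
  | Scan d changed L, Some None =>
    let w := label_of c2 in
    rewind (Row d (changed || (L != w.2))) 1 MoveRight
      (Some (w.1, L)) MoveRight
  | Final d E, _ =>
    if c1 is Some _ then
      run (Final d (E :|: final (label_of c1)))
        Stay None MoveRight None Stay
    else stop (decide d E)
  | _, _ => stop false
  end.

(** Rewinding goes left up to the blank before the contents, then one cell back to the right. *)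
Definition trans (q : state) (c0 c1 c2 : cellT) :
    state * move * (option label * move) * (option label * move) :=
  match q with
  | inl q => phase_trans q c0 c1 c2
  | inr (i, q) =>
    let c := if i == 0 :> nat then c0 else if i == 1 :> nat then c1 else c2 in
    let m := if c is Some _ then MoveLeft else MoveRight in
    (if c is Some _ then inr (i, q) else inl q,
     (if i == 0 :> nat then m else Stay),
     (None, if i == 1 :> nat then m else Stay),
     (None, if i == 2 :> nat then m else Stay))
  end.

Definition machine : TM letter :=
  three_tape_TM (inl (SkipRows true)) verdict trans.

(** * Rewinding a tape *)

Notation config q z0 z1 z2 := (@ZC letter label state q z0 z1 z2).
Notation reaches := (reach verdict trans).
Notation zip_tape := (seq cellT * seq cellT)%type.

(** [all isSome l] keeps the head from stopping early. The initial [zmove] is the unconditional left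
    move of [rewind], and the blank visited on the left is invisible to [zeq]. *)
Lemma rewind0 q l r z1 z2 : all isSome l ->
  reaches (size l).+1 (config (inr (inord 0, q)) (zmove MoveLeft (l, r)) z1 z2)
    (config (inl q) ([::], catrev l r) z1 z2).
Proof.
elim: l r => [|[a|] l IH] r //= hl; apply: reachS; rewrite /zstep /= inordK //=.
  by apply: reach0; split=> //; split=> // -[|[]].
exact: IH.
Qed.

Lemma rewind1 q l r z0 z2 : all isSome l ->
  reaches (size l).+1 (config (inr (inord 1, q)) z0 (zmove MoveLeft (l, r)) z2)
    (config (inl q) z0 ([::], catrev l r) z2).
Proof.
elim: l r => [|[a|] l IH] r //= hl; apply: reachS; rewrite /zstep /= inordK //=.
  by apply: reach0; split=> //; split=> // -[|[]].
exact: IH.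
Qed.

Lemma rewind2 q l r z0 z1 : all isSome l ->
  reaches (size l).+1 (config (inr (inord 2, q)) z0 z1 (zmove MoveLeft (l, r)))
    (config (inl q) z0 z1 ([::], catrev l r)).
Proof.
elim: l r => [|[a|] l IH] r //= hl; apply: reachS; rewrite /zstep /= inordK //=.
  by apply: reach0; split=> //; split=> // -[|[]].
exact: IH.
Qed.

Definition inp (x : seq letter) : seq cellT := [seq Some (inl c) | c <- x].

Lemma isSome_inp x l : all isSome l -> all isSome (catrev (inp x) l).
Proof. by elim: x l => //= a x IH l hl; apply: IH. Qed.

Lemma catrev_inp_cat x y l :
  catrev (inp (x ++ y)) l = catrev (inp y) (catrev (inp x) l).
Proof. by rewrite /inp map_cat catrev_catl. Qed.

Lemma catrev_inp_rcons x a l :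
  catrev (inp (rcons x a)) l = Some (inl a) :: catrev (inp x) l.
Proof. by rewrite -cats1 catrev_inp_cat. Qed.

Section Graph.
Variable V : Type.
Implicit Types (s : seq V) (f : V -> bool) (w : V -> label).

Definition bits f s : seq letter := [seq Some (f v) | v <- s].

Definition labels w s : seq cellT := [seq Some (inr (w v)) | v <- s].

Lemma isSome_labels w s l : all isSome l -> all isSome (catrev (labels w s) l).
Proof. by elim: s l => //= a s IH l hl; apply: IH. Qed.

Lemma catrevK (X : Type) (s r : seq X) : catrev (catrev s [::]) r = s ++ r.
Proof. by rewrite !catrevE cats0 revK. Qed.

Lemma size_catrev0 (X : Type) (s : seq X) : size (catrev s [::]) = size s.
Proof. by rewrite catrevE cats0 size_rev. Qed.

(** * Reading the adjacency matrix, the bundles and the budget *)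

Lemma skip_bits b f s l x z1 z2 :
  reaches (size s) (config (inl (SkipRows b)) (l, inp (bits f s ++ x)) z1 z2)
    (config (inl (SkipRows (b && nilp s)))
       (catrev (inp (bits f s)) l, inp x) z1 z2).
Proof.
elim: s b l => [|v s IH] b l; first by rewrite andbT; apply: reach0.
by rewrite andbF; apply: reachS; rewrite /zstep /=; apply: IH.
Qed.

Variables (adj : V -> V -> bool) (vs : seq V).

Definition row u := rcons (bits (adj u) vs) None.

(** Without vertices a row would be a bare separator, taken for the end of the matrix; hence the
    hypothesis. *)
Lemma skip_rows us l x z1 z2 : (nilp vs -> nilp us) ->
  reaches (size us * (size vs).+1).+1
    (config (inl (SkipRows true))
       (l, inp (flatten [seq row u | u <- us] ++ None :: x)) z1 z2)
    (config (inl (Bundles ord0))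
       (catrev (inp (rcons (flatten [seq row u | u <- us]) None)) l, inp x)
       z1 z2).
Proof.
elim: us l => [|u us IH] l h; first by apply: reachS; apply: reach0.
rewrite /= mulSn -addnS rcons_cat catrev_inp_cat -catA.
have hn : nilp vs = false by apply/negP => /h.
have {}h : nilp vs -> nilp us by rewrite hn.
apply: reach_trans (IH _ h); rewrite /row -cats1 -catA -addn1.
apply: reach_trans (skip_bits _ _ _ _ _ _ _) _.
rewrite hn; apply: reachS; apply: reach0.
by rewrite catrev_inp_cat.
Qed.

Definition mark (j : nat) f (g : V -> cellT) (v : V) : cellT :=
  Some (inr (add_bundle (inZp j) (f v) (label_of (g v)).1, (label_of (g v)).2)).

Lemma read_bits j f g s l x z1 l2 :
  reaches (size s)
    (config (inl (ReadBundle (inZp j))) (l, inp (bits f s ++ x)) z1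
       (l2, [seq g v | v <- s]))
    (config (inl (ReadBundle (inZp j))) (catrev (inp (bits f s)) l, inp x) z1
       (catrev [seq mark j f g v | v <- s] l2, [::])).
Proof.
elim: s l l2 => [|v s IH] l l2; first exact: reach0.
by apply: reachS; rewrite /zstep /=; apply: IH.
Qed.

(** The suffix [[:: Some true; None]] is the weight 1 in binary with its separator. *)
Definition bundle_word f : seq letter :=
  rcons (bits f vs) None ++ [:: Some true; None].

Lemma read_bundle j f g l x z1 : ~~ nilp vs ->
  reaches (2 * size vs + 5)
    (config (inl (Bundles (inZp j))) (l, inp (bundle_word f ++ x)) z1
       ([::], [seq g v | v <- vs]))
    (config (inl (Bundles (inZp j.+1))) (catrev (inp (bundle_word f)) l, inp x)
       z1 ([::], [seq mark j f g v | v <- vs])).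
Proof.
move=> hn; rewrite /bundle_word -cats1 -!catA.
(* With [n] vertices: one step to enter [ReadBundle], [n] to mark, one for the separator, [n + 1] to
   rewind tape 2 and two for the weight. *)
have -> : 2 * size vs + 5 = (size vs + ((size vs).+1 + 2).+1).+1 by lia.
apply: reachS.
set a := zstep _ _ _.
have -> : a = config (inl (ReadBundle (inZp j)))
    (l, inp (bits f vs ++ [:: None] ++ [:: Some true; None] ++ x)) z1
    ([::], [seq g v | v <- vs]).
  by rewrite /a; case: (vs) hn.
apply: reach_trans (read_bits _ _ _ _ _ _ _ _) _.
apply: reachS; rewrite /zstep /=.
have h : all isSome (catrev [seq mark j f g v | v <- vs] [::]).
  by rewrite catrevE cats0 all_rev; elim: (vs).
have := rewind2 (Weight (inZp j)) [::]
  (Some (inl None) :: catrev (inp (bits f vs)) l, inp [:: Some true, None & x])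
  z1 h.
rewrite catrevK cats0 size_catrev0 size_map => h'.
apply: reach_trans h' _.
do 2!(apply: reachS; rewrite /zstep /=).
apply: reach0; split=> //=.
  by congr (inl (Bundles _)); apply: val_inj; rewrite /= -addn1 modnDml addn1.
by rewrite !catrev_inp_cat.
Qed.

Fixpoint read_marks j (fs : seq (V -> bool)) g : V -> cellT :=
  if fs is f :: fs' then read_marks j.+1 fs' (mark j f g) else g.

Lemma read_bundles j fs g l x z1 : (nilp vs -> nilp fs) ->
  reaches (size fs * (2 * size vs + 5))
    (config (inl (Bundles (inZp j)))
       (l, inp (flatten [seq bundle_word f | f <- fs] ++ x)) z1
       ([::], [seq g v | v <- vs]))
    (config (inl (Bundles (inZp (j + size fs))))
       (catrev (inp (flatten [seq bundle_word f | f <- fs])) l, inp x)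
       z1 ([::], [seq read_marks j fs g v | v <- vs])).
Proof.
elim: fs j g l => [|f fs IH] j g l h; first by rewrite addn0; apply: reach0.
have hn : ~~ nilp vs by apply/negP => /h.
rewrite /= -[j + _]addSnnS mulSn -catA catrev_inp_cat.
apply: reach_trans (read_bundle _ _ _ _ _ _ hn) _.
by apply: IH => h'; case/negP: hn.
Qed.

Lemma read_digits m d (ds : seq bool) l x z1 z2 :
  reaches (size ds)
    (config (inl (Budget m d)) (l, inp ([seq Some b | b <- ds] ++ x)) z1 z2)
    (config (inl (Budget m (foldl add_digit d ds)))
       (catrev (inp [seq Some b | b <- ds]) l, inp x) z1 z2).
Proof.
elim: ds d l => [|b ds IH] d l; first exact: reach0.
by apply: reachS; rewrite /zstep /=; apply: IH.
Qed.

(** * One round of label propagation *)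

Lemma copy_cells d g w s l1 l2 z0 :
  reaches (size s)
    (config (inl (Copy d)) z0 (l1, [seq g v | v <- s]) (l2, labels w s))
    (config (inl (Copy d)) z0 (catrev (labels w s) l1, [::])
       (catrev (labels w s) l2, [::])).
Proof.
elim: s l1 l2 => [|v s IH] l1 l2; first exact: reach0.
apply: reachS; rewrite /zstep /=.
exact: IH.
Qed.

(** The old contents [g] of tape 1 are arbitrary but lie on the cells that get overwritten: this
    covers both a blank tape and the labels of an earlier round. *)
Lemma copy d g w z0 :
  reaches (3 * size vs + 4)
    (config (inl (Copy d)) z0 ([::], [seq g v | v <- vs]) ([::], labels w vs))
    (config (inl (Row d false)) z0 ([::], labels w vs) ([::], labels w vs)).
Proof.
have -> : 3 * size vs + 4 = size vs + ((size vs).+1 + (size vs).+1.+1).+1.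
  by lia.
apply: reach_trans (copy_cells _ _ _ _ _ _ _) _.
have h : all isSome (catrev (labels w vs) [::]) by apply: isSome_labels.
have hs : size (catrev (labels w vs) [::]) = size vs.
  by rewrite size_catrev0 size_map.
apply: reachS; rewrite /zstep /=.
have h1 := rewind1 (RewindOut false d) [::] z0
  (catrev (labels w vs) [::], [::]) h.
rewrite catrevK cats0 hs in h1; apply: reach_trans h1 _.
apply: reachS; rewrite /zstep /=.
have h2 := rewind2 (Row d false) [::] z0 ([::], labels w vs) h.
by rewrite catrevK cats0 hs in h2.
Qed.

Definition gather w f s (L : {set T}) :=
  foldl (fun L v => if f v then L :|: contrib (w v) else L) L s.

Lemma scan_bits d c f w s L l x l1 z2 :
  reaches (size s)
    (config (inl (Scan d c L)) (l, inp (bits f s ++ x)) (l1, labels w s) z2)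
    (config (inl (Scan d c (gather w f s L)))
       (catrev (inp (bits f s)) l, inp x) (catrev (labels w s) l1, [::]) z2).
Proof.
elim: s L l l1 => [|v s IH] L l l1; first exact: reach0.
by apply: reachS; rewrite /zstep /=; apply: IH.
Qed.

(** Contributions come from the old labels, held on tape 1, so a round updates all vertices
    simultaneously. *)
Definition sweep w u : label := ((w u).1, gather w (adj u) vs (w u).2).

Lemma scan_row d c w u l x l2 r2 : ~~ nilp vs ->
  reaches (2 * size vs + 3)
    (config (inl (Row d c)) (l, inp (row u ++ x)) ([::], labels w vs)
       (l2, Some (inr (w u)) :: r2))
    (config (inl (Row d (c || ((sweep w u).2 != (w u).2))))
       (catrev (inp (row u)) l, inp x) ([::], labels w vs)
       (Some (inr (sweep w u)) :: l2, r2)).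
Proof.
move=> hn; rewrite /row -cats1 -!catA.
have -> : 2 * size vs + 3 = (size vs + (size vs).+1.+1).+1 by lia.
apply: reachS.
set a := zstep _ _ _.
have -> : a = config (inl (Scan d c (w u).2))
    (l, inp (bits (adj u) vs ++ [:: None] ++ x)) ([::], labels w vs)
    (l2, Some (inr (w u)) :: r2).
  by rewrite /a; case: (vs) hn.
apply: reach_trans (scan_bits _ _ _ _ _ _ _ _ _ _) _.
apply: reachS; rewrite /zstep /=.
have h : all isSome (catrev (labels w vs) [::]) by apply: isSome_labels.
have := rewind1 (Row d (c || ((sweep w u).2 != (w u).2))) [::]
  (catrev (inp (bits (adj u) vs ++ [:: None])) l, inp x)
  (Some (inr (sweep w u)) :: l2, r2) h.
by rewrite catrevK cats0 size_catrev0 size_map catrev_inp_cat.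
Qed.

Lemma scan_rows d c w us l x l2 : (nilp vs -> nilp us) ->
  reaches (size us * (2 * size vs + 3))
    (config (inl (Row d c)) (l, inp (flatten [seq row u | u <- us] ++ x))
       ([::], labels w vs) (l2, labels w us))
    (config (inl (Row d (c || has (fun u => (sweep w u).2 != (w u).2) us)))
       (catrev (inp (flatten [seq row u | u <- us])) l, inp x)
       ([::], labels w vs) (catrev (labels (sweep w) us) l2, [::])).
Proof.
elim: us c l l2 => [|u us IH] c l l2 h; first by rewrite orbF; apply: reach0.
have hn : ~~ nilp vs by apply/negP => /h.
rewrite /= mulSn -catA catrev_inp_cat orbA.
apply: reach_trans (scan_row _ _ _ _ _ _ _ _ hn) _.
by apply: IH => h'; case/negP: hn.
Qed.

Lemma final_scan d E w s l z0 z2 :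
  reaches (size s).+1
    (config (inl (Final d E)) z0 (l, labels w s) z2)
    (config (inl (Halt (decide d (foldl (fun E v => E :|: final (w v)) E s))))
       z0 (catrev (labels w s) l, [::]) z2).
Proof.
elim: s E l => [|v s IH] E l; apply: reachS; rewrite /zstep /=.
  exact: reach0.
exact: IH.
Qed.

(** * Number of rounds until the labels are stable *)

Lemma sub_gather w f s (L : {set T}) : L \subset gather w f s L.
Proof.
elim: s L => //= v s IH L; case: (f v) => //.
by apply: subset_trans (IH _); apply: subsetUl.
Qed.

(* Bounds the number of further rounds. *)
Definition deficit w := \sum_(v <- vs) (#|T| - #|(w v).2|).

Lemma ltn_sum_has (a b : V -> nat) s : (forall v, a v <= b v) ->
  has (fun v => a v < b v) s -> \sum_(v <- s) a v < \sum_(v <- s) b v.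
Proof.
move=> hab; elim: s => //= v s IH; rewrite !big_cons => /orP[h | /IH h].
  by rewrite -addSn leq_add // leq_sum.
by rewrite -addnS leq_add.
Qed.

(** Entry sets only grow, so a set that changes grows strictly, within the bound [#|T|]. *)
Lemma deficit_sweep w : has (fun u => (sweep w u).2 != (w u).2) vs ->
  deficit (sweep w) < deficit w.
Proof.
have hsub u : (w u).2 \subset (sweep w u).2 by apply: sub_gather.
move=> h; apply: ltn_sum_has => [v|].
  by apply: leq_sub2l; apply: subset_leq_card.
apply: sub_has h => u h.
have hlt : #|(w u).2| < #|(sweep w u).2|.
  by apply: proper_card; rewrite properEneq eq_sym h hsub.
by apply: ltn_sub2l (hlt); apply: leq_trans (hlt) (max_card _).
Qed.

(** The exact cost of a round that changes a label: copying, scanning all rows, then rewinding the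
    input and tape 2. The last round, with its final scan, is cheaper. *)
Definition sweep_time := 3 * size vs ^ 2 + 8 * size vs + 8.

Lemma size_rows us :
  size (flatten [seq row u | u <- us]) = size us * (size vs).+1.
Proof.
by elim: us => //= u us IH; rewrite size_cat IH size_rcons size_map mulSn.
Qed.

Definition graph_word y := flatten [seq row u | u <- vs] ++ None :: y.

(** Each round that changes a label lowers the deficit, so at most [k] such rounds precede the
    stable one, which ends with the final scan. *)
Lemma saturate k d g w y : deficit w <= k ->
  exists i, let w' := iter i sweep w in
    all (fun u => (sweep w' u).2 == (w' u).2) vs /\
    exists z0 z1 z2, reaches (k.+1 * sweep_time)
      (config (inl (Copy d)) ([::], inp (graph_word y))
         ([::], [seq g v | v <- vs]) ([::], labels w vs))
      (config (inl (Halt (decide d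
         (foldl (fun E v => E :|: final (w' v)) set0 vs)))) z0 z1 z2).
Proof.
pose rows := flatten [seq row u | u <- vs].
elim: k g w => [|k IH] g w hk.
all: have hrow : reaches (3 * size vs + 4 + size vs * (2 * size vs + 3))
  (config (inl (Copy d)) ([::], inp (graph_word y))
     ([::], [seq g v | v <- vs]) ([::], labels w vs))
  (config (inl (Row d (has (fun u => (sweep w u).2 != (w u).2) vs)))
     (catrev (inp rows) [::], inp (None :: y)) ([::], labels w vs)
     (catrev (labels (sweep w) vs) [::], [::]))
  by apply: reach_trans (copy _ _ _ _) _; apply: scan_rows.
all: have [hc|hc] := boolP (has (fun u => (sweep w u).2 != (w u).2) vs).
(* For [k = 0] the deficit is zero and no label can change. *)
1: by have := deficit_sweep hc; lia.
2: {
have [|i [hfix [z0 [z1 [z2 hi]]]]] := IH (fun v => Some (inr (w v))) (sweep w).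
  by have := deficit_sweep hc; lia.
exists i.+1; rewrite iterSr; split=> //; exists z0, z1, z2.
rewrite hc in hrow; rewrite mulSn; apply: reach_trans hi.
apply: (@reach_leq _ _ _ _ _ ((3 * size vs + 4 + size vs * (2 * size vs + 3)) +
  ((size vs * (size vs).+1).+1 + (size vs).+1.+1).+1)).
  by rewrite /sweep_time; nia.
apply: reach_trans hrow _; apply: reachS; rewrite /zstep /=.
have h0 : all isSome (catrev (inp rows) [::]) by apply: isSome_inp.
have := rewind0 (RewindOut true d) (inp (None :: y)) ([::], labels w vs)
  (catrev (labels (sweep w) vs) [::], [::]) h0.
rewrite catrevK size_catrev0 size_map size_rows -map_cat => h0'.
apply: reach_trans h0' _; apply: reachS; rewrite /zstep /=.
have h2 : all isSome (catrev (labels (sweep w) vs) [::]).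
  exact: isSome_labels.
have := rewind2 (Copy d) [::] ([::], inp (graph_word y)) ([::], labels w vs) h2.
by rewrite catrevK cats0 size_catrev0 size_map.
}
(* In the two remaining cases no label changes: [w] is already a fixpoint. *)
all: exists 0; split; first by rewrite -[all _ _]negbK -has_predC.
all: rewrite (negbTE hc) in hrow; do 3!eexists.
all: apply: (@reach_leq _ _ _ _ _
  ((3 * size vs + 4 + size vs * (2 * size vs + 3)) + (size vs).+2));
  last by apply: reach_trans hrow _; apply: reachS; rewrite /zstep /=;
    apply: final_scan.
all: by rewrite /sweep_time; nia.
Qed.

(** * The whole run on the word of an instance *)

Definition initial (fs : seq (V -> bool)) v : label :=
  label_of (read_marks 0 fs (fun=> None) v).

(** If there is a vertex then there is a bundle, and reading it replaces every blank by a label. *)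
Lemma read_marks_labels fs : nilp vs = nilp fs ->
  [seq read_marks 0 fs (fun=> None) v | v <- vs] = labels (initial fs) vs.
Proof.
rewrite /initial; case: fs => [|f fs] h; first by case: (vs) h.
apply: eq_map => v; rewrite /=.
suff H (F : seq (V -> bool)) j g : g v = Some (inr (label_of (g v))) ->
    read_marks j F g v = Some (inr (label_of (read_marks j F g v))) by apply: H.
by elim: F j g => //= f' F IH j g hg; apply: IH.
Qed.

Definition instance_word fs (ds : seq bool) :=
  graph_word (flatten [seq bundle_word f | f <- fs] ++
    None :: [seq Some b | b <- ds]).

Lemma size_instance_word fs ds : size (instance_word fs ds) =
  size vs * (size vs).+1 + size fs * (size vs + 3) + size ds + 2.
Proof.
rewrite /instance_word /graph_word size_cat size_rows /= size_cat /= size_map.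
suff -> : size (flatten [seq bundle_word f | f <- fs]) =
    size fs * (size vs + 3).
  by lia.
elim: fs => //= f fs IH; rewrite size_cat IH mulSn size_cat size_rcons size_map.
by rewrite /=; lia.
Qed.

Lemma parse fs ds : nilp vs = nilp fs ->
  reaches (3 * size (instance_word fs ds) + 2)
    (config (inl (SkipRows true)) ([::], inp (instance_word fs ds))
       ([::], [::]) ([::], [::]))
    (config
       (inl (Copy (inZp (size fs), (foldl add_digit (ord0, ord0) ds).2)))
       ([::], inp (instance_word fs ds))
       ([::], [seq None | _ <- vs]) ([::], labels (initial fs) vs)).
Proof.
move=> hfs; set x := instance_word fs ds.
(* Up to padding, an empty tape already has one blank cell per vertex. *)
have hnone : zeq ([::], [::]) ([::] : seq cellT, [seq None | _ <- vs]).
  by split=> // k; rewrite nth_nil; elim: (vs) k => [|v s IH] [|k] //=.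
apply: (@reach_eql _ _ _ _ _ _ _ (config (inl (SkipRows true)) ([::], inp x)
   ([::], [seq None | _ <- vs]) ([::], [seq None | _ <- vs]))) => //.
apply: (@reach_leq _ _ _ _ _ ((size vs * (size vs).+1).+1 +
  (size fs * (2 * size vs + 5) + (size ds + (size x).+1.+1).+1))).
  by rewrite /x size_instance_word; nia.
have hn : nilp vs -> nilp vs by [].
apply: reach_trans (skip_rows _ _ _ _ hn) _.
have -> : Bundles ord0 = Bundles (inZp 0) :> phase T T'.
  by congr Bundles; apply: val_inj.
have {}hn : nilp vs -> nilp fs by rewrite hfs.
apply: reach_trans (read_bundles _ _ _ _ _ hn) _.
apply: reachS; rewrite /zstep /= add0n.
rewrite -[[seq Some b | b <- ds]]cats0.
apply: reach_trans (read_digits _ _ _ _ _ _ _) _.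
apply: reachS; rewrite /zstep /=.
(* The input has been read to its end, so [l] is its reversal and rewinding restores it. *)
set l := catrev _ (Some (inl None) :: _).
have hl : l = catrev (inp x) [::].
  rewrite /x /instance_word /graph_word -cat_rcons -(cat_rcons None).
  rewrite !catrev_inp_cat.
  by rewrite (catrev_inp_rcons (flatten [seq bundle_word _ | _ <- _])).
have h : all isSome l by rewrite hl; apply: isSome_inp.
have := rewind0 (Copy (inZp (size fs), (foldl add_digit (ord0, ord0) ds).2))
  [::] ([::], [seq None | _ <- vs]) ([::], labels (initial fs) vs) h.
rewrite {2 3}hl catrevK cats0 hl size_catrev0 size_map -read_marks_labels //.
Qed.

Lemma machine_answers fs ds k : nilp vs = nilp fs ->
  3 * size (instance_word fs ds) + 2 +
    (size vs * #|T|).+1 * sweep_time <= k ->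
  exists i, let w := iter i sweep (initial fs) in
    all (fun u => (sweep w u).2 == (w u).2) vs /\
    tm_answers_within machine (instance_word fs ds)
      k (decide (inZp (size fs), (foldl add_digit (ord0, ord0) ds).2)
        (foldl (fun E v => E :|: final (w v)) set0 vs)).
Proof.
move=> hfs hk.
have hdef : deficit (initial fs) <= size vs * #|T|.
  apply: (@leq_trans (\sum_(v <- vs) #|T|)); last first.
    by rewrite big_const_seq count_predT iter_addn_0 mulnC.
  by apply: leq_sum => v _; apply: leq_subr.
have [i [hfix [z0 [z1 [z2 hi]]]]] := saturate
  (inZp (size fs), (foldl add_digit (ord0, ord0) ds).2) (fun=> None)
  (flatten [seq bundle_word f | f <- fs] ++
     None :: [seq Some b | b <- ds]) hdef.
exists i; split=> //.
by apply: answers_of_reach (reach_leq hk (reach_trans (parse _ hfs) hi)) _.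
Qed.

End Graph.
End Machine.

(** * Labels at the fixpoint *)

Lemma read_marks_snd (T : finType) (V : Type) j (fs : seq (V -> bool))
    (g : V -> cell letter (label T)) v :
  (label_of (read_marks j fs g v)).2 = (label_of (g v)).2.
Proof. by elim: fs j g => //= f fs IH j g; rewrite IH. Qed.

Lemma read_marks_fst (T : finType) (V : Type) j (fs : seq (V -> bool))
    (g : V -> cell letter (label T)) v (i : 'I_4) : j + size fs <= 4 ->
  (i \in (label_of (read_marks j fs g v)).1) =
  (i \in (label_of (g v)).1) || ((j <= i) && nth xpred0 fs (i - j) v).
Proof.
elim: fs j g => [|f fs IH] j g /= hj; first by rewrite nth_nil andbF orbF.
rewrite IH; last by lia.
rewrite /= /add_bundle.
(* The bound on [j + size fs] gives [j < 4], so [inZp] does not wrap around. *)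
have hij : (i == inZp j) = (i == j :> nat).
  by rewrite -val_eqE /= modn_small //; lia.
have -> : (i \in (if f v then inZp j |: (label_of (g v)).1
   else (label_of (g v)).1)) =
   (i == j :> nat) && f v || (i \in (label_of (g v)).1).
  by case: (f v); rewrite ?inE ?hij ?andbT ?andbF.
case: (ltngtP j i) => [hlt|hlt|->]; rewrite /= ?orbF //.
  by rewrite -[i - j]subnSK.
by rewrite subnn /= orbC.
Qed.

Lemma in_gather (T : finType) (contrib : label T -> {set T}) (V : Type)
    (w : V -> label T) f (s : seq V) (L : {set T}) x :
  (x \in gather contrib w f s L) =
  (x \in L) || has (fun v => f v && (x \in contrib (w v))) s.
Proof.
elim: s L => [|v s IH] L /=; first by rewrite orbF.
by rewrite IH; case: (f v) => //=; rewrite inE orbA.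
Qed.

Lemma in_foldl_setU (T : finType) (V : Type) (F : V -> {set T}) (s : seq V)
    (E : {set T}) x :
  (x \in foldl (fun E v => E :|: F v) E s) =
  (x \in E) || has (fun v => x \in F v) s.
Proof.
by elim: s E => [|v s IH] E /=; rewrite ?orbF // IH inE orbA.
Qed.

(* [(D, None)]: some neighbor is in a bundle of [D].  [(D, Some b)]: some walk
   of positive length from a vertex of a bundle of [D] ends here, and its length
   is odd iff [b]. *)
Definition entry : finType := ({set 'I_4} * option bool)%type.
(* [(D, true)]: the vertices of the bundles of [D] cannot all get color 1 in a
   coloring with two colors.  [(D, false)]: they are not independent. *)
Definition conflict : finType := ({set 'I_4} * bool)%type.

Definition meets (D S : {set 'I_4}) := D :&: S != set0.

(** A neighbor starts a walk of length one, which is odd, and extends its own walks by one edge,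
    which flips their parity. *)
Definition walk_contrib (w : label entry) : {set entry} :=
  [set e | if e.2 is Some b then
             (b && meets e.1 w.1) || ((e.1, Some (~~ b)) \in w.2)
           else meets e.1 w.1].

(** In the even case, [meets] accounts for the walk of length zero. *)
Definition conflicts (w : label entry) : {set conflict} :=
  [set e | if e.2 then
             (meets e.1 w.1 || ((e.1, Some false) \in w.2)) &&
             ((e.1, Some true) \in w.2)
           else meets e.1 w.1 && ((e.1, None) \in w.2)].

(** The two disjuncts are the two cases of the criterion, with the inequalities stated without
    subtraction. *)
Definition decide (d : counters) (E : {set conflict}) : bool :=
  [exists D : {set 'I_4}, (D \subset [set j : 'I_4 | j < d.1]) &&
    (((D, true) \notin E) && (2 * d.1 <= d.2 + #|D|) ||
     ((D, false) \notin E) && (3 * d.1 <= d.2 + 2 * #|D|))].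

(** * Soundness and completeness of the stable labels *)

Section Saturation.
Variables (V : finType) (adj : rel V) (own : V -> {set 'I_4}).
Hypothesis adj_sym : symmetric adj.
Variable w0 : V -> label entry.
Hypothesis w0E : forall v, w0 v = (own v, set0).
Variable i : nat.

Notation step := (sweep walk_contrib adj (enum V)).

Let w := iter i step w0.

Hypothesis w_fixed : all (fun u => (step w u).2 == (w u).2) (enum V).

Definition all_conflicts :=
  foldl (fun E v => E :|: conflicts (w v)) set0 (enum V).

Definition two_coloring (phi : V -> bool) :=
  forall u v, adj u v -> phi u != phi v.

Lemma iter_fst k v : (iter k step w0 v).1 = own v.
Proof. by elim: k => [|k IH] /=; rewrite ?w0E. Qed.

Lemma in_all_conflicts e :
  (e \in all_conflicts) = [exists v, e \in conflicts (w v)].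
Proof.
rewrite in_foldl_setU inE /=; apply/hasP/existsP => -[v]; first by exists v.
by move=> h; exists v; rewrite ?mem_enum.
Qed.

(** Soundness principle: a property that survives propagation along an edge holds for every entry
    ever derived. *)
Lemma iter_ind (P : V -> entry -> Prop) k :
  (forall u v (e : entry) (S : {set entry}), adj u v ->
     (forall e', e' \in S -> P v e') ->
     e \in walk_contrib (own v, S) -> P u e) ->
  forall v e, e \in (iter k step w0 v).2 -> P v e.
Proof.
move=> hP; elim: k => [|k IH] v e /=; first by rewrite w0E inE.
rewrite in_gather => /orP[/IH //|/hasP[u _ /andP[huv he]]].
apply: (hP v u e (iter k step w0 u).2) => //; first by move=> e'; apply: IH.
by rewrite -(iter_fst k u) -surjective_pairing.
Qed.

(** Completeness counterpart of [iter_ind]: at a fixpoint, propagating once more adds nothing. *)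
Lemma closed u v e : adj u v -> e \in walk_contrib (w v) -> e \in (w u).2.
Proof.
move=> huv he; have /allP/(_ u) := w_fixed.
rewrite mem_enum => /(_ isT)/eqP <-; rewrite in_gather; apply/orP; right.
by apply/hasP; exists v; rewrite ?mem_enum ?huv.
Qed.

Lemma extendable D : (exists X : {set V}, two_coloring (fun v => v \in X)) ->
  ((D, true) \notin all_conflicts) <->
  (exists phi, two_coloring phi /\ forall v, meets D (own v) -> phi v).
Proof.
case=> X hX; rewrite in_all_conflicts negb_exists.
split=> [/forallP h | [phi [hphi hD]]].
  pose even v := meets D (own v) || ((D, Some false) \in (w v).2).
  pose odd v := (D, Some true) \in (w v).2.
  have heo v : ~~ (even v && odd v) by have := h v; rewrite inE /= iter_fst.
  have even_odd u v : adj u v -> even v -> odd u.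
    by move=> huv hv; apply: (closed huv); rewrite inE /= iter_fst.
  have odd_even u v : adj u v -> odd v -> even u.
    move=> huv hv; apply/orP; right; apply: (closed huv).
    by rewrite inE /=.
  (* Vertices reached by even walks get [true], those reached by odd walks [false], and unreached
     ones follow [X]. Edges swap [even] and [odd], so none joins a reached vertex to an unreached
     one. *)
  exists (fun v => even v || (v \in X) && ~~ odd v); split; last first.
    by move=> v hv; rewrite /even hv.
  move=> u v huv; have hvu : adj v u by rewrite adj_sym.
  have := heo u; have := heo v; have := hX _ _ huv; rewrite /=.
  move: (even_odd _ _ huv) (even_odd _ _ hvu).
  move: (odd_even _ _ huv) (odd_even _ _ hvu).
  move: (even u) (even v) (odd u) (odd v) (u \in X) (v \in X).
  by do 6!case=> //=; intuition.
(* Along a walk from a vertex of color [true], the color is determined by the parity of the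
   length. *)
pose P v (e : entry) := e.1 = D -> if e.2 is Some b then phi v = ~~ b else True.
have sound v e : e \in (w v).2 -> P v e.
  apply: iter_ind; rewrite /P.
  move=> {}v u [D' [b|]] S huv hS //= hb eD; rewrite eD inE /= in hb.
  have := hphi _ _ huv; case/orP: hb => [/andP[-> /hD ->]|/hS /= -> //].
    by case: (phi v).
  by case: b; case: (phi v).
apply/forallP => v; rewrite inE /= iter_fst; apply/negP => /andP[h1 h2].
have := sound _ _ h2 erefl; case/orP: h1 => [/hD /= ->|h1] //.
by rewrite (sound _ _ h1 erefl).
Qed.

Lemma independent D : ((D, false) \notin all_conflicts) <->
  (forall u v, adj u v -> meets D (own u) -> ~~ meets D (own v)).
Proof.
rewrite in_all_conflicts negb_exists; split=> [/forallP h u v huv hu | h].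
  apply/negP => hv; have := h u; rewrite inE /= iter_fst hu /= => /negP; apply.
  by apply: (closed huv); rewrite inE /= iter_fst.
apply/forallP => v; rewrite inE /= iter_fst; apply/negP => /andP[hv h2].
pose P u (e : entry) := e = (D, None) -> exists2 x, adj u x & meets D (own x).
have sound u e : e \in (w u).2 -> P u e.
  apply: iter_ind; rewrite /P.
  by move=> {}u x {}e S hux _ he eE; move: he; rewrite eE inE /=; exists x.
have [x hx hDx] := sound _ _ h2 erefl.
by have := h _ _ hx hv; rewrite hDx.
Qed.

End Saturation.

(** Values below 8 are checked one by one. From 8 on there are at least four digits, and the fourth
    makes the counters saturate. *)
Lemma foldl_digits C : 0 < C ->
  exists2 ds : seq bool, binary C = [seq Some b | b <- ds] &
    (foldl add_digit (ord0, ord0) ds).2 = minn C 7 :> nat.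
Proof.
move=> C0; exists (mkseq (fun i => odd (C %/ 2 ^ i)) (trunc_log 2 C).+1).
  by rewrite /binary /mkseq -map_comp.
have [C8|C8] := ltnP C 8.
  by move: C C0 C8; do 8!case=> //.
have [k ->] : exists k, trunc_log 2 C = k.+3.
  exists (trunc_log 2 C - 3); suff: 3 <= trunc_log 2 C by lia.
  by apply: trunc_log_max.
rewrite (minn_idPr _); last by apply: leq_trans C8.
rewrite /mkseq /=.
set d := add_digit _ _.
(* [d] is the state after four digits, which further digits preserve. *)
have hd : d.1 = 3 :> nat /\ d.2 = 7 :> nat by [].
elim: map d hd => [|b ds IH] d [h1 h2] //=.
by apply: IH; rewrite /= h1.
Qed.

(** * Colorings with at most three bundles *)

Section Criterion.
Variable I : instance.
Hypotheses (bipI : bipartite I) (unifI : uniform_weights I).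
Hypothesis nbI : nbundles I <= 3.
Notation V := 'I_(nvertices I).
Notation nb := (nbundles I).

(** Bundle indices are embedded in ['I_4] because the machine is fixed before the instance. *)
Definition owners (v : V) : {set 'I_4} :=
  [set i : 'I_4 | [exists j : 'I_nb, (j == i :> nat) && (v \in bundle j)]].

Definition hit D (v : V) := meets D (owners v).

Lemma hitP (D : {set 'I_4}) v :
  reflect (exists2 j : 'I_nb, inord j \in D & v \in bundle j) (hit D v).
Proof.
apply: (iffP (set0Pn _)) => [[i]|[j hj hv]].
  rewrite 2!inE => /andP[hi /existsP[j /andP[/eqP hj hv]]]; exists j => //.
  by rewrite (_ : inord j = i) //; apply: val_inj; rewrite /= inordK ?hj.
exists (inord j); rewrite 2!inE hj; apply/existsP; exists j.
by rewrite inordK ?eqxx //; have := ltn_ord j; lia.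
Qed.

(** Writes [#|D|] as a sum over bundles, to be compared with the cost term by term. *)
Lemma sum_inord (D : {set 'I_4}) : D \subset [set i : 'I_4 | i < nb] ->
  \sum_(j < nb) (inord j \in D : nat) = #|D|.
Proof.
move=> /subsetP hD; rewrite -sum1_card [RHS]big_mkcond /=.
rewrite [RHS](eq_bigr (fun i : 'I_4 => (inord i \in D : nat))) => [|i _];
  last first.
  by rewrite inord_val; case: (i \in D).
have hle : nb <= 4 by lia.
rewrite (big_ord_widen 4 (fun i => (@inord 3 i \in D : nat)) hle) big_mkcond /=.
apply: eq_bigr => i _; case: ifP => // hi; rewrite inord_val.
by case hiD: (i \in D) => //; move/hD: hiD; rewrite inE hi.
Qed.

(** A bundle of [D] costs at most [K - k], any other at most [K]. The uses are [K = 2], [k = 1] and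
    [K = 3], [k = 2]. *)
Lemma cost_le (c : V -> nat) (D : {set 'I_4}) K k C :
  D \subset [set i : 'I_4 | i < nb] -> k <= K ->
  (forall v, c v <= K) -> (forall v, hit D v -> c v + k <= K) ->
  K * nb <= C + k * #|D| -> bundle_cost c <= C.
Proof.
move=> hD hk hK hhit hC; rewrite -(leq_add2r (k * #|D|)); apply: leq_trans hC.
rewrite -(sum_inord hD) big_distrr /= /bundle_cost -big_split /=.
apply: (@leq_trans (\sum_(j < nb) K)); last first.
  by rewrite sum_nat_const card_ord mulnC.
apply: leq_sum => j _; rewrite unifI mul1n.
have [hj|hj] := boolP (inord j \in D); last first.
  by rewrite muln0 addn0; apply/bigmax_leqP.
have hmax : \max_(v in bundle j) c v <= K - k.
  apply/bigmax_leqP => v hv.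
  have /hhit : hit D v by apply/hitP; exists j.
  by lia.
by rewrite muln1 -(subnK hk) leq_add2r.
Qed.

Definition extendable_from (D : {set 'I_4}) := exists phi : V -> bool,
  two_coloring (@adj I) phi /\ forall v, hit D v -> phi v.

Definition independent_hits (D : {set 'I_4}) :=
  forall u v : V, adj u v -> hit D u -> ~~ hit D v.

Lemma mscb_of_extendable (D : {set 'I_4}) : D \subset [set i : 'I_4 | i < nb] ->
  extendable_from D -> 2 * nb <= budget I + #|D| -> mscb I.
Proof.
move=> hD [phi [hphi hhit]] hC.
exists (fun v => if phi v then 1 else 2); split.
  split=> [v|u v /hphi]; first by case: (phi v).
  by case: (phi u); case: (phi v).
apply: (@cost_le _ D 2 1) => //; last by rewrite mul1n.
  by move=> v; case: (phi v).
by move=> v /hhit ->.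
Qed.

Lemma mscb_of_independent (D : {set 'I_4}) :
  D \subset [set i : 'I_4 | i < nb] ->
  independent_hits D -> 3 * nb <= budget I + 2 * #|D| -> mscb I.
Proof.
case: bipI => X hX hD hind hC.
exists (fun v => if hit D v then 1 else if v \in X then 2 else 3); split.
  split=> [v|u v huv]; first by case: (hit D v); case: (v \in X).
  have := hX _ _ huv; have := hind _ _ huv.
  by case: (hit D u); case: (hit D v); case: (u \in X); case: (v \in X) => //=
    /(_ isT).
apply: (@cost_le _ D 3 2) => //.
  by move=> v; case: (hit D v); case: (v \in X).
by move=> v ->.
Qed.

(** Capping the budget at 7 is harmless: [2 * nb] is at most 6, and the second alternative is only
    chosen for [nb = 3] and [#|D| = 2], where 5 suffices. *)
Lemma criterion_of_mscb : mscb I -> exists2 D : {set 'I_4},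
  D \subset [set i : 'I_4 | i < nb] &
  extendable_from D /\ 2 * nb <= minn (budget I) 7 + #|D| \/
  independent_hits D /\ 3 * nb <= minn (budget I) 7 + 2 * #|D|.
Proof.
case=> c [[cpos cproper] hC].
pose k (j : 'I_nb) := \max_(v in bundle j) c v.
have ck j v : v \in bundle j -> c v <= k j by move=> hv; apply: leq_bigmax_cond.
have kpos j : 0 < k j.
  by have /set0Pn[v hv] := bundle_neq0 j; apply: leq_trans (ck j v hv).
have {}hC : \sum_j k j <= budget I.
  by apply: leq_trans hC; apply: leq_sum => j _; rewrite unifI mul1n.
pose D := [set i : 'I_4 | [exists j : 'I_nb, (j == i :> nat) && (k j <= 1)]].
have hD : D \subset [set i : 'I_4 | i < nb].
  by apply/subsetP => i; rewrite !inE => /existsP[j /andP[/eqP <- _]].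
have inD (j : 'I_nb) : (inord j \in D) = (k j <= 1).
  have hj : (inord j : 'I_4) = j :> nat.
    by rewrite inordK //; have := ltn_ord j; lia.
  rewrite inE hj; apply/existsP/idP => [[j' /andP[/eqP/val_inj ->]] //|h].
  by exists j; rewrite eqxx.
have hit1 v : hit D v -> c v = 1.
  by case/hitP=> j; rewrite inD => h1 /ck h2; have := cpos v; lia.
have [hk|] := boolP [forall j, k j <= 2].
  exists D => //; left; split.
    exists (fun v => c v == 1); split; last by move=> v /hit1 ->.
    have c2 v : c v <= 2.
      by have [j /ck h] := bundle_cover v; apply: leq_trans h (forallP hk j).
    move=> u v /cproper huv; have := (cpos u, cpos v, c2 u, c2 v).
    by move: (c u) (c v) huv => [|[|[|?]]] [|[|[|?]]] //= ? [[[]]].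
  (* A bundle outside [D] has maximal color at least 2, one in [D] exactly 1. *)
  have : \sum_(j < nb) 2 <= \sum_(j < nb) (k j + (inord j \in D)).
    by apply: leq_sum => j _; rewrite inD; have := kpos j; lia.
  rewrite big_split /= sum_inord // sum_nat_const card_ord.
  move=> h; have := leq_trans h (leq_add hC (leqnn _)).
  by move: #|D| nb (budget I) nbI => d m C; lia.
rewrite negb_forall => /existsP[j0]; rewrite -ltnNge => hj0.
have sum_j0 : \sum_(j < nb) (j == j0 : nat) = 1.
  by rewrite -big_mkcond /= big_pred1_eq.
(* The bundle [j0] exceeds the previous lower bound by one. *)
have hlow : nb * 2 + 1 <= budget I + #|D|.
  apply: (@leq_trans (\sum_(j < nb) (2 + (j == j0)))).
    by rewrite big_split /= sum_j0 sum_nat_const card_ord.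
  rewrite -(sum_inord hD).
  apply: leq_trans (leq_add hC (leqnn _)); rewrite -big_split /=.
  apply: leq_sum => j _; rewrite inD; have := kpos j.
  by have [->|_] := eqVneq j j0; lia.
(* [j0] is not in [D]. *)
have hcard : #|D| + 1 <= nb.
  have : \sum_(j < nb) ((inord j \in D) + (j == j0)) <= \sum_(j < nb) 1.
    by apply: leq_sum => j _; rewrite inD; have [->|_] := eqVneq j j0; lia.
  by rewrite big_split /= sum_inord // sum_j0 sum_nat_const card_ord muln1.
have [h1|h1] := leqP #|D| 1.
  (* By [hlow] the budget is at least [2 * nb], enough for any coloring with colors 1 and 2. *)
  exists set0; first exact: sub0set.
  left; split; last first.
    by rewrite cards0; move: #|D| nb (budget I) nbI hlow hcard h1 => d m C; lia.
  case: bipI => X hX; exists (fun v => v \in X); split=> // v.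
  by case/hitP=> j; rewrite inE.
(* Here [2 <= #|D| < nb <= 3], so [hlow] yields a budget of at least 5, and 9 = 5 + 2 * 2. *)
exists D => //; right; split; last first.
  by move: #|D| nb (budget I) nbI hlow hcard h1 => d m C; lia.
move=> u v /cproper huv /hit1 hu; apply/negP => /hit1 hv.
by apply: huv; rewrite hu hv.
Qed.

End Criterion.

(** * Correctness on encoded instances *)

Definition bundle_tests (I : instance) : seq ('I_(nvertices I) -> bool) :=
  [seq (fun v => v \in bundle j) | j <- enum 'I_(nbundles I)].

Lemma encode_instance_word (I : instance) (ds : seq bool) :
  uniform_weights I -> binary (budget I) = [seq Some b | b <- ds] ->
  encode I = instance_word (@adj I) (enum 'I_(nvertices I)) (bundle_tests I) ds.
Proof.
move=> unifI hds; rewrite /encode /instance_word /graph_word hds.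
congr (flatten _ ++ _ :: flatten _ ++ _).
  apply: eq_map => u; congr rcons; rewrite /indicator /bits.
  by apply: eq_map => v; rewrite inE.
rewrite /bundle_tests -[RHS]map_comp; apply: eq_map => j /=.
by rewrite unifI.
Qed.

Lemma initial_owners (T : finType) (I : instance) : nbundles I <= 3 ->
  forall v, initial T (bundle_tests I) v = (@owners I v, set0).
Proof.
move=> nbI v; rewrite [LHS]surjective_pairing /initial read_marks_snd /=.
congr (_, _); apply/setP => i; rewrite read_marks_fst; last first.
  by rewrite size_map size_enum_ord; lia.
rewrite !inE /= subn0; apply/idP/existsP => [h|[j /andP[/eqP <- hv]]].
  have hi : i < nbundles I.
    rewrite ltnNge; apply/negP => hi; move: h.
    by rewrite nth_default // size_map size_enum_ord.
  exists (Ordinal hi); rewrite /= eqxx /=; move: h.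
  rewrite (nth_map (Ordinal hi)) ?size_enum_ord //.
  by rewrite (nth_ord_enum _ (Ordinal hi)).
by rewrite (nth_map j) ?size_enum_ord // nth_ord_enum.
Qed.

(** Every bundle contains a vertex and every vertex lies in a bundle. *)
Lemma bundles_nil (I : instance) :
  nilp (enum 'I_(nvertices I)) = nilp (bundle_tests I).
Proof.
rewrite /nilp /bundle_tests [X in _ = (X == 0)]size_map !size_enum_ord.
apply/eqP/eqP => h; apply/eqP; rewrite -leqn0 leqNgt; apply/negP => h'.
  have /set0Pn[v _] := bundle_neq0 (Ordinal h').
  by have := leq_ltn_trans (leq0n v) (ltn_ord v); rewrite h.
have [j _] := bundle_cover (Ordinal h').
by have := leq_ltn_trans (leq0n j) (ltn_ord j); rewrite h.
Qed.

(** With [n] vertices and word length [N], replacing [n] by [N] gives a cubic polynomial, written in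
    Horner form to match the evaluation of [Poly]. *)
Lemma time_bound n N T : n <= N ->
  3 * N + 2 + (n * T).+1 * (3 * n ^ 2 + 8 * n + 8) <=
  ((3 * T * N + (3 + 8 * T)) * N + (11 + 8 * T)) * N + 10.
Proof.
move=> h.
apply: (@leq_trans (3 * N + 2 + (N * T).+1 * (3 * N ^ 2 + 8 * N + 8))).
  rewrite leq_add2l leq_mul ?ltnS ?leq_mul //.
  by rewrite leq_add2r leq_add ?leq_mul // leq_sqr.
by rewrite leq_eqVlt; apply/orP; left; apply/eqP; ring.
Qed.

Theorem theorem13 :
  poly_time_solvable_on encode
    (fun I : instance => bipartite I /\ uniform_weights I /\ nbundles I <= 3)
    mscb.
Proof.
pose t := #|entry|.
exists (machine walk_contrib conflicts decide).
(* The coefficients are those of [time_bound], constant term first; [t] does not depend on the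
   instance. *)
exists (Poly [:: 10; 11 + 8 * t; 3 + 8 * t; 3 * t]).
move=> I [bipI [unifI nbI]].
have [ds hds hval] := foldl_digits (budget_gt0 I).
set vs := enum 'I_(nvertices I).
have hn : size vs = nvertices I by rewrite size_enum_ord.
rewrite (encode_instance_word unifI hds) horner_Poly.
set x := instance_word _ _ _ _.
have hx : nvertices I <= size x.
  by rewrite /x size_instance_word hn mulnS -!addnA leq_addr.
set p := horner_rec _ _.
have hp : 3 * size x + 2 + (size vs * t).+1 * sweep_time vs <= p.
  have -> : p =
      ((3 * t * size x + (3 + 8 * t)) * size x + (11 + 8 * t)) * size x + 10.
    by rewrite /p /= GRing.mul0r GRing.add0r.
  by rewrite /sweep_time hn; apply: time_bound.
have [i [hfix hans]] := @machine_answers entry conflict walk_contrib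
  conflicts decide _ (@adj I) vs (bundle_tests I) ds p (bundles_nil I) hp.
set E := (X in decide _ X) in hans; set d := (X in decide X _) in hans.
exists (decide d E); split=> //.
have hext (D : {set 'I_4}) : ((D, true) \notin E) <-> extendable_from I D.
  exact: (extendable (@adj_sym I) (initial_owners entry nbI) hfix D bipI).
have hind (D : {set 'I_4}) : ((D, false) \notin E) <-> independent_hits I D.
  exact: (independent (initial_owners entry nbI) hfix D).
have hd1 : d.1 = nbundles I :> nat.
  by rewrite /= size_map size_enum_ord modn_small //; lia.
have hle : minn (budget I) 7 <= budget I by apply: geq_minl.
rewrite /decide hd1 hval; split=> [/existsP[D /andP[hD]] | h].
  case/orP=> /andP[].
    move=> /hext he hc; apply: (mscb_of_extendable unifI nbI hD he).
    by apply: leq_trans hc _; rewrite leq_add2r.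
  move=> /hind he hc; apply: (mscb_of_independent bipI unifI nbI hD he).
  by apply: leq_trans hc _; rewrite leq_add2r.
have [D hD hDc] := criterion_of_mscb bipI unifI nbI h.
apply/existsP; exists D; rewrite hD /=.
by case: hDc => -[] => [/hext|/hind] -> ->; rewrite ?orbT.
Qed.
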